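(* Let $\delta=(C,(C_i)_{i\in I_\delta})$ be a universal regular $m$-polytope, where $C=\langle c_0,c_1,\ldots,c_{m-1}\rangle$ is a string Coxeter group with Coxeter graph $\mathcal{G}$. Let $\beta=(B,(B_i)_{i\in I_\beta})$ be an abstract regular polytope having finitely many, and more than one, $0$-elements, and let $\mathcal{D}=\mathcal{D}(\beta,0,\lambda)$ be a Coxeter graph obtained from the $0$-diagonals of $\beta$. Identify the vertex of $\mathcal{G}$ corresponding to $c_{m-1}$ with the vertex $B_0$ of $\mathcal{D}$, and let $\mathcal{K}=\operatorname{Ext}(\mathcal{G},\mathcal{D})$. If $F_L=B_0$ (as representative of the orbit $L=V(\mathcal{D})$), then $$\delta^{\beta,\mathcal{G}}\cong\mathcal{T}(\alpha,\beta),$$ where $\alpha$ is the standard coset incidence system of $W(\mathcal{K})$ and the twisting is taken with respect to the induced action $\eta$ of $B$ on $W(\mathcal{K})$.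
   Context: Coset incidence systems. Given a group $B$ and a family $(B_i)_{i\in I_\beta}$ of subgroups (the maximal parabolic subgroups), the coset incidence system $(B,(B_i)_{i\in I_\beta})$ has as elements of type $i$ the left cosets $bB_i$; two cosets are incident if they intersect. For $J\subseteq I_\beta$, $B_J=\bigcap_{i\in J}B_i$, $B_\emptyset=B$. An abstract regular $n$-polytope with automorphism group $B=\langle\rho_0,\ldots,\rho_{n-1}\rangle$ (distinguished generators) is viewed as $(B,(B_i)_{0\le i\le n-1})$ with $B_i=\langle\rho_k\mid k\ne i\rangle$; in particular $C_i=\langle c_k\mid k\neq i\rangle$ with $I_\delta=\{0,\ldots,m-1\}$. Below $n$ denotes the rank of $\beta$. Coxeter graphs. A Coxeter graph is a simple graph with edges labelled by elements of $\{3,4,\ldots\}\cup\{\infty\}$; $m_{s,t}$ is the label of $\{s,t\}$, and $m_{s,t}=2$ for distinct non-adjacent $s,t$. $W(\mathcal{G})$ is generated by $a_s$ ($s\in V(\mathcal{G})$) with defining relations $a_s^2=1$ and $(a_sa_t)^{m_{s,t}}=1$ when $m_{s,t}<\infty$. Its standard coset incidence system is $(W(\mathcal{G}),(W(\mathcal{G})_s)_{s\in V(\mathcal{G})})$ with $W(\mathcal{G})_s=\langle a_t\mid t\ne s\rangle$. A string Coxeter group $\langle c_0,\ldots,c_{m-1}\rangle$ is a Coxeter group in which $c_i$ and $c_k$ commute whenever $|i-k|\ge2$. Diagonal Coxeter graph. Let $X_0=\{\sigma B_0\mid\sigma\in B\}$. A $0$-diagonal is an unordered pair $\{F_1,F_2\}$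 of distinct elements of $X_0$. Two $0$-diagonals are equivalent if some $b\in B$ maps one to the other (as unordered pairs); the class is $[F_1,F_2]$ and $\mathcal{C}^0_\beta$ is the set of classes. Given a label function $\lambda:\mathcal{C}^0_\beta\to\{2,3,\ldots\}\cup\{\infty\}$, $\mathcal{D}(\beta,0,\lambda)$ has vertex set $X_0$, with distinct $F_1,F_2$ joined iff $\lambda([F_1,F_2])\ne2$, the edge then being labelled $\lambda([F_1,F_2])$. Extension. Let $\mathcal{G},\mathcal{D}$ be Coxeter graphs with distinguished vertices $v_{\mathcal{G}},v_{\mathcal{D}}$ and otherwise disjoint vertex sets. $\operatorname{Ext}(\mathcal{G},\mathcal{D})$ has vertex set obtained from $V(\mathcal{G})\sqcup V(\mathcal{D})$ by identifying $v_{\mathcal{G}}$ and $v_{\mathcal{D}}$ to one vertex $v$; all edges of $\mathcal{G}$ and $\mathcal{D}$ remain with their labels; if $w\in V(\mathcal{G})\setminus\{v\}$ is joined to $v$ in $\mathcal{G}$ with label $q$, then $w$ is joined to every $w'\in V(\mathcal{D})\setminus\{v\}$ with label $q$; there are no other edges. Action. $B$ acts on $V(\mathcal{K})$ by fixing each vertex of $V(\mathcal{G})\setminus\{v\}$ and by left multiplication on $V(\mathcal{D})=X_0$; with $A=W(\mathcal{K})$, $\eta:B\to\operatorname{Aut}(A)$ is given by $\eta(b)(a_s)=a_{b\cdot s}$. Twisting. Let $\alpha=(A,(A_i)_{i\in V(\mathcal{K})})$ be the standard coset incidence system of $A$, let $\Omega$ be the set of $B$-orbits on $V(\mathcal{K})$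 (namely $V(\mathcal{D})$ and the singletons of $V(\mathcal{G})\setminus\{v\}$), and choose representatives $F_L\in L$ for $L\in\Omega$. Then $\mathcal{T}(\alpha,\beta)=(G,(G_i)_{i\in I_\beta\sqcup\Omega})$ with $G=A\rtimes_\eta B$, $G_i=A_{\bigcup_{L\in\Omega}(L\setminus (B_i\cdot F_L))}\rtimes B_i$ for $i\in I_\beta$, and $G_L=A_L\rtimes B$ for $L\in\Omega$, where $A_J=\bigcap_{i\in J}A_i$ for $J\subseteq V(\mathcal{K})$, $A_\emptyset=A$. The McMullen–Schulte polytope $\delta^{\beta,\mathcal{G}}$ (which depends also on $\mathcal{D}$). It is the abstract regular $(m+n)$-polytope with automorphism group $W(\mathcal{K})\rtimes_\eta B$ and distinguished generators $\tau_i=a_{c_i}$ for $0\le i\le m-2$ (the generator at the vertex of $\mathcal{G}$ corresponding to $c_i$), $\tau_{m-1}=a_{B_0}$, and $\tau_{m+i}=\rho_i$ for $0\le i\le n-1$; that is, its $i$-faces are the left cosets of $\langle\tau_k\mid k\ne i\rangle$, two faces being incident iff the cosets intersect. The symbol $\cong$ denotes isomorphism of polytopes, regarded as incidence geometries, with the type $\{c_i\}$ of $\mathcal{T}(\alpha,\beta)$ corresponding to rank $i$ for $i\le m-2$, the type $V(\mathcal{D})$ to rank $m-1$, and the type $i\in I_\beta$ to rank $m+i$. *)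

(* Defs.v *)
From HB Require Import structures.
From Stdlib Require Import Relation_Operators.
From mathcomp Require Import all_boot all_order.
From mathcomp Require Import boolp classical_sets functions cardinality.

Set Implicit Arguments.
Unset Strict Implicit.
Unset Printing Implicit Defensive.

Local Open Scope classical_set_scope.
Local Open Scope quotient_scope.
Local Open Scope card_scope.
Local Open Scope group_scope.

(** * Subgroups and left cosets of a possibly infinite group *)

Definition is_subgroup (G : groupType) (H : set G) : Prop :=
  H 1 /\ forall x y, H x -> H y -> H (x * y^-1).

Definition generated (G : groupType) (S : set G) : set G :=
  smallest (@is_subgroup G) S.

Definition lcoset (G : groupType) (b : G) (X : set G) : set G :=
  [set b * x | x in X].

Definition lcosets (G : groupType) (H : set G) : set (set G) :=
  [set lcoset b H | b in [set: G]].

(** The subgroup generated by all the [r k] with [k <> i]. *)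
Definition parabolic (I : Type) (G : groupType) (r : I -> G) (i : I) : set G :=
  generated [set r k | k in [set k | k <> i]].

(** * Incidence systems *)

Record incidenceSystem (I : Type) := IncidenceSystem {
  elt : Type;
  typ : elt -> I;
  inc : elt -> elt -> Prop
}.

Definition coset_system (I : Type) (G : groupType) (H : I -> set G) :
    incidenceSystem I :=
  @IncidenceSystem I {i : I & lcosets (H i)} (@tag _ _)
    (fun x y => (val (tagged x) `&` val (tagged y)) !=set0).

Definition isomorphic_along (I J : Type) (phi : I -> J)
    (S : incidenceSystem I) (T : incidenceSystem J) : Prop :=
  bijective phi /\
  exists f : elt S -> elt T,
    [/\ bijective f,
        forall x, typ (f x) = phi (typ x) &
        forall x y, inc (f x) (f y) <-> inc x y].

(** * Abstract regular polytopes

    The ranks of an abstract [n]-polytope, usually [-1, ..., n], are shifted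
    by one: [rk] takes values in [0, ..., n.+1], the least face has [rk] equal
    to [0] and the [i]-faces are the [x] such that [rk x = i.+1]. *)

Section Polytope.
Context {d : Order.disp_t} {P : tbPOrderType d}.
Implicit Types (rk : P -> nat) (Phi Psi : set P).

Definition is_chain Phi : Prop :=
  forall x y, Phi x -> Phi y -> (x <= y)%O \/ (y <= x)%O.

Definition is_flag Phi : Prop :=
  is_chain Phi /\ forall Psi, is_chain Psi -> Phi `<=` Psi -> Psi = Phi.

Definition rank_adjacent rk (r : nat) Phi Psi : Prop :=
  Phi <> Psi /\ forall x, rk x <> r -> (Phi x <-> Psi x).

(** One step between adjacent flags, both containing the set of faces [S]. *)
Definition flag_step rk (S Phi Psi : set P) : Prop :=
  [/\ is_flag Phi, is_flag Psi, S `<=` Phi, S `<=` Psi &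
      exists r, rank_adjacent rk r Phi Psi].

Record is_abstract_polytope (n : nat) rk : Prop := {
  rank_lt : forall x y : P, (x < y)%O -> (rk x < rk y)%N;
  flag_rank : forall Phi, is_flag Phi -> set_bij Phi `I_n.+2 rk;
  strongly_flag_connected : forall Phi Psi, is_flag Phi -> is_flag Psi ->
    clos_refl_trans _ (flag_step rk (Phi `&` Psi)) Phi Psi;
  diamond : forall x y : P, (x < y)%O -> rk y = (rk x).+2 ->
    [set z : P | (x < z)%O /\ (z < y)%O] #= `I_2
}.

(** [B], acting through [act], is the automorphism group of [P], it is
    transitive on the flags, and the [rho i] are the distinguished generators
    with respect to some base flag. *)
Record is_regular_with_group (n : nat) rk (B : groupType) (rho : 'I_n -> B)
    (act : B -> P -> P) : Prop := {
  polytope_act1 : forall x, act 1 x = x;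
  polytope_actM : forall b c x, act (b * c) x = act b (act c x);
  polytope_act_le : forall b x y, (act b x <= act b y)%O = (x <= y)%O;
  polytope_act_faithful : forall b, (forall x, act b x = x) -> b = 1;
  polytope_act_full : forall f : P -> P, bijective f ->
    (forall x y, (f x <= f y)%O = (x <= y)%O) -> exists b, act b =1 f;
  flag_transitive : forall Phi Psi, is_flag Phi -> is_flag Psi ->
    exists b, act b @` Phi = Psi;
  distinguished : exists2 Phi, is_flag Phi &
    forall i : 'I_n, rank_adjacent rk i.+1 Phi (act (rho i) @` Phi);
  distinguished_generate : generated (range rho) = [set: B]
}.

End Polytope.

(** [B] is the automorphism group of an abstract regular [n]-polytope, with
    distinguished generators [rho]. *)
Definition is_regular_polytope (n : nat) (B : groupType) (rho : 'I_n -> B) :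
    Prop :=
  exists (d : Order.disp_t) (P : tbPOrderType d) (rk : P -> nat)
         (act : B -> P -> P),
    is_abstract_polytope n rk /\ is_regular_with_group rk rho act.

Definition polytope_system (n : nat) (B : groupType) (rho : 'I_n -> B) :
    incidenceSystem 'I_n :=
  coset_system (parabolic rho).

(** * Groups given by a presentation

    A letter [(v, false)] stands for the generator [v], and [(v, true)] for its
    inverse. *)

Definition word (V : Type) := seq (V * bool).

Inductive word_equiv (V : Type) (R : word V -> Prop) :
    word V -> word V -> Prop :=
| we_refl u : word_equiv R u u
| we_sym u v : word_equiv R u v -> word_equiv R v u
| we_trans u v w : word_equiv R u v -> word_equiv R v w -> word_equiv R u w
| we_cat u u' v v' :
    word_equiv R u u' -> word_equiv R v v' -> word_equiv R (u ++ v) (u' ++ v')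
| we_cancel s e : word_equiv R [:: (s, e); (s, ~~ e)] [::]
| we_relator u : R u -> word_equiv R u [::].

Section Presentation.
Context {V : choiceType} (R : word V -> Prop).

Definition word_eqb (u v : word V) : bool := `[< word_equiv R u v >].

Lemma word_eqb_refl : reflexive word_eqb.
Proof. by move=> u; apply/asboolP; exact: we_refl. Qed.

Lemma word_eqb_sym : symmetric word_eqb.
Proof.
by move=> u v; apply/asboolP/asboolP; exact: we_sym.
Qed.

Lemma word_eqb_trans : transitive word_eqb.
Proof.
move=> v u w /asboolP uv /asboolP vw; apply/asboolP; exact: we_trans uv vw.
Qed.

Canonical word_equivrel :=
  EquivRel word_eqb word_eqb_refl word_eqb_sym word_eqb_trans.

Definition presented : Type := {eq_quot word_equivrel}.
HB.instance Definition _ := Choice.on presented.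
HB.instance Definition _ := EqQuotient.on presented.

Definition word_class (u : word V) : presented := \pi_presented u.

Lemma word_classP u v : word_class u = word_class v <-> word_equiv R u v.
Proof.
split=> [/eqP|uv]; first by rewrite eqmodE => /asboolP.
by apply/eqP; rewrite eqmodE; apply/asboolP.
Qed.

Lemma word_class_repr (x : presented) : word_class (repr x) = x.
Proof. exact: reprK. Qed.

Lemma repr_word_class u : word_equiv R (repr (word_class u)) u.
Proof. by apply/word_classP; rewrite word_class_repr. Qed.

Definition word_inv (u : word V) : word V :=
  rev [seq (l.1, ~~ l.2) | l <- u].

Lemma word_invK : involutive word_inv.
Proof.
move=> u; rewrite /word_inv map_rev revK -map_comp -[RHS]map_id.
by apply: eq_map => -[s e] /=; rewrite negbK.
Qed.

Lemma word_mulV u : word_equiv R (u ++ word_inv u) [::].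
Proof.
elim: u => [|[s e] u IH]; first exact: we_refl.
rewrite /word_inv /= rev_cons -cats1 -/(word_inv u) catA.
apply: (@we_trans _ _ _ ([:: (s, e)] ++ [::] ++ [:: (s, ~~ e)])).
  apply: (@we_cat _ _ [:: (s, e)] [:: (s, e)]
            ((u ++ word_inv u) ++ [:: (s, ~~ e)])); first exact: we_refl.
  by apply: we_cat => //; exact: we_refl.
exact: we_cancel.
Qed.

Lemma word_Vmul u : word_equiv R (word_inv u ++ u) [::].
Proof. by rewrite -{2}(word_invK u); exact: word_mulV. Qed.

Lemma word_inv_equiv u v : word_equiv R u v ->
  word_equiv R (word_inv u) (word_inv v).
Proof.
move=> uv; apply: (@we_trans _ _ _ (word_inv u ++ (v ++ word_inv v))).
  rewrite -{1}(cats0 (word_inv u)); apply: we_cat; first exact: we_refl.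
  exact/we_sym/word_mulV.
rewrite catA; apply: (@we_trans _ _ _ ([::] ++ word_inv v)); last exact: we_refl.
apply: we_cat; last exact: we_refl.
apply: (@we_trans _ _ _ (word_inv u ++ u)); last exact: word_Vmul.
by apply: we_cat; [exact: we_refl | exact: we_sym].
Qed.

Definition presented_one : presented := word_class [::].
Definition presented_mul (x y : presented) : presented :=
  word_class (repr x ++ repr y).
Definition presented_inv (x : presented) : presented :=
  word_class (word_inv (repr x)).

Lemma presented_mulE u v :
  presented_mul (word_class u) (word_class v) = word_class (u ++ v).
Proof. by apply/word_classP; apply: we_cat; exact: repr_word_class. Qed.

Lemma presented_invE u :
  presented_inv (word_class u) = word_class (word_inv u).
Proof. by apply/word_classP; apply: word_inv_equiv; exact: repr_word_class. Qed.

Lemma presented_mulA : associative presented_mul.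
Proof.
move=> x y z; rewrite -(word_class_repr x) -(word_class_repr y).
by rewrite -(word_class_repr z) !presented_mulE catA.
Qed.

Lemma presented_mul1 : left_id presented_one presented_mul.
Proof. by move=> x; rewrite -(word_class_repr x) presented_mulE. Qed.

Lemma presented_mulr1 : right_id presented_one presented_mul.
Proof. by move=> x; rewrite -(word_class_repr x) presented_mulE cats0. Qed.

Lemma presented_mulV : left_inverse presented_one presented_inv presented_mul.
Proof.
move=> x; rewrite -(word_class_repr x) presented_invE presented_mulE.
exact/word_classP/word_Vmul.
Qed.

Lemma presented_mulrV :
  right_inverse presented_one presented_inv presented_mul.
Proof.
move=> x; rewrite -(word_class_repr x) presented_invE presented_mulE.
exact/word_classP/word_mulV.
Qed.

HB.instance Definition _ := isGroup.Build presented presented_mulA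
  presented_mul1 presented_mulr1 presented_mulV presented_mulrV.

Definition presented_gen (s : V) : presented := word_class [:: (s, false)].

End Presentation.

(** * Coxeter graphs and Coxeter groups *)

(** The elements of [{2, 3, ...}] together with infinity, the latter being
    [None]. *)
Record label := Label {
  label_val :> option nat;
  label_ge2 : if label_val is Some k then (1 < k)%N else true
}.

Definition label2 : label := @Label (Some 2) isT.

(** [cox_label s t] is [m_{s,t}]: distinct [s] and [t] are adjacent exactly
    when it is not [2].  The value of [cox_label s s] is irrelevant. *)
Record coxeterGraph (V : Type) := CoxeterGraph {
  cox_label :> V -> V -> label;
  cox_label_sym : forall s t, cox_label s t = cox_label t s
}.

Inductive cox_relator (V : Type) (K : coxeterGraph V) : word V -> Prop :=
| cox_square s : cox_relator K [:: (s, false); (s, false)]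
| cox_braid s t k : s <> t -> label_val (K s t) = Some k ->
    cox_relator K (flatten (nseq k [:: (s, false); (t, false)])).

Definition coxeter (V : choiceType) (K : coxeterGraph V) : groupType :=
  presented (cox_relator K).

Definition cox_gen (V : choiceType) (K : coxeterGraph V) (s : V) : coxeter K :=
  presented_gen (cox_relator K) s.

(** [C] is a Coxeter group with Coxeter graph [K], the generator [c s]
    corresponding to the vertex [s]. *)
Definition is_coxeter_system (V : choiceType) (K : coxeterGraph V)
    (C : groupType) (c : V -> C) : Prop :=
  exists2 f : {multiplicative coxeter K -> C},
    bijective f & forall s, f (cox_gen K s) = c s.

Definition is_string (m : nat) (C : groupType) (c : 'I_m -> C) : Prop :=
  forall i k : 'I_m, (i.+1 < k)%N -> commute (c i) (c k).

(** * Group actions and semidirect products *)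

Record setAction (B : groupType) (V : Type) := SetAction {
  sact :> B -> V -> V;
  sact1 : forall x, sact 1 x = x;
  sactM : forall b c x, sact (b * c) x = sact b (sact c x)
}.

Definition sorbit (B : groupType) (V : Type) (a : setAction B V) (x : V) :
    set V :=
  [set a b x | b in [set: B]].

Definition orbits (B : groupType) (V : Type) (a : setAction B V) :
    set (set V) :=
  [set sorbit a x | x in [set: V]].

Lemma sorbit_subproof (B : groupType) (V : Type) (a : setAction B V) (x : V) :
  sorbit a x \in orbits a.
Proof. by apply/mem_set; exists x. Qed.

Definition orbit_of (B : groupType) (V : Type) (a : setAction B V) (x : V) :
    orbits a :=
  exist _ (sorbit a x) (sorbit_subproof a x).

(** An action of [B] on the group [A] by automorphisms, that is, a
    homomorphism from [B] to the automorphism group of [A]. *)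
Record autAction (B A : groupType) := AutAction {
  autact :> B -> A -> A;
  autact1 : forall x, autact 1 x = x;
  autactM : forall b c x, autact (b * c) x = autact b (autact c x);
  autact_mul : forall b x y, autact b (x * y) = autact b x * autact b y
}.

Definition sdprod (B A : groupType) (eta : autAction B A) : Type :=
  (A * B)%type.

Section SemidirectProduct.
Context {B A : groupType} (eta : autAction B A).

HB.instance Definition _ := Choice.copy (sdprod eta) (A * B)%type.

Definition sdprod_one : sdprod eta := (1, 1).
Definition sdprod_mul (x y : sdprod eta) : sdprod eta :=
  (x.1 * eta x.2 y.1, x.2 * y.2).
Definition sdprod_inv (x : sdprod eta) : sdprod eta := (eta x.2^-1 x.1^-1, x.2^-1).

Lemma autact_one b : eta b 1 = 1.
Proof. by apply: (mulgI (eta b 1)); rewrite -autact_mul !mulg1. Qed.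

Lemma sdprod_mulA : associative sdprod_mul.
Proof.
by move=> x y z; rewrite /sdprod_mul /= autact_mul autactM !mulgA.
Qed.

Lemma sdprod_mul1 : left_id sdprod_one sdprod_mul.
Proof. by case=> x b; rewrite /sdprod_mul /= autact1 !mul1g. Qed.

Lemma sdprod_mulr1 : right_id sdprod_one sdprod_mul.
Proof. by case=> x b; rewrite /sdprod_mul /= autact_one !mulg1. Qed.

Lemma sdprod_mulV : left_inverse sdprod_one sdprod_inv sdprod_mul.
Proof.
by case=> x b; rewrite /sdprod_mul /= -autact_mul !mulVg autact_one.
Qed.

Lemma sdprod_mulrV : right_inverse sdprod_one sdprod_inv sdprod_mul.
Proof.
by case=> x b; rewrite /sdprod_mul /= -autactM !mulgV autact1 mulgV.
Qed.

HB.instance Definition _ := isGroup.Build (sdprod eta) sdprod_mulA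
  sdprod_mul1 sdprod_mulr1 sdprod_mulV sdprod_mulrV.

End SemidirectProduct.

(** An action on the vertices of a Coxeter graph which preserves the labels
    induces an action on the Coxeter group, [b] mapping the generator at [s] to
    the generator at [b s]: see [coxeter_act_gen]. *)
Section InducedAction.
Context {B : groupType} {V : choiceType} {K : coxeterGraph V}.
Context (a : setAction B V).
Hypothesis aK : forall b s t, K (a b s) (a b t) = K s t.

Definition word_act (b : B) (u : word V) : word V :=
  [seq (a b l.1, l.2) | l <- u].

Lemma word_act_equiv b u v : word_equiv (cox_relator K) u v ->
  word_equiv (cox_relator K) (word_act b u) (word_act b v).
Proof.
elim=> {u v} [u|u v _|u v w _ IH1 _ IH2|u u' v v' _ IH1 _ IH2|s e|u].
- exact: we_refl.
- exact: we_sym.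
- exact: we_trans IH1 IH2.
- by rewrite /word_act !map_cat; exact: we_cat.
- exact: we_cancel.
- case=> [s|s t k st stk]; apply: we_relator; first exact: cox_square.
  rewrite /word_act map_flatten map_nseq /=; apply: cox_braid.
    by move=> /(congr1 (a b^-1)); rewrite -!sactM mulVg !sact1.
  by rewrite aK.
Qed.

Definition coxeter_act (b : B) (x : coxeter K) : coxeter K :=
  word_class (cox_relator K) (word_act b (repr x)).

Lemma coxeter_act_class b u :
  coxeter_act b (word_class (cox_relator K) u) =
  word_class (cox_relator K) (word_act b u).
Proof. by apply/word_classP; apply: word_act_equiv; exact: repr_word_class. Qed.

Lemma coxeter_act_gen b s : coxeter_act b (cox_gen K s) = cox_gen K (a b s).
Proof. exact: coxeter_act_class. Qed.

Lemma coxeter_act1 x : coxeter_act 1 x = x.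
Proof.
rewrite -[x]word_class_repr coxeter_act_class; congr word_class.
by rewrite -[RHS]map_id; apply: eq_map => -[s e] /=; rewrite sact1.
Qed.

Lemma coxeter_actM b c x :
  coxeter_act (b * c) x = coxeter_act b (coxeter_act c x).
Proof.
rewrite -[x]word_class_repr !coxeter_act_class; congr word_class.
by rewrite /word_act -map_comp; apply: eq_map => -[s e] /=; rewrite sactM.
Qed.

Lemma coxeter_act_mul b (x y : coxeter K) :
  coxeter_act b (x * y) = coxeter_act b x * coxeter_act b y.
Proof.
rewrite -[x]word_class_repr -[y]word_class_repr.
rewrite [X in coxeter_act b X]presented_mulE !coxeter_act_class.
by rewrite [RHS]presented_mulE /word_act map_cat.
Qed.

Definition coxeter_action : autAction B (coxeter K) :=
  AutAction coxeter_act1 coxeter_actM coxeter_act_mul.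

End InducedAction.

(** * The diagonal Coxeter graph *)

Section Diagonals.
Context {B : groupType} (H : set B).

Lemma lcoset_act_subproof (b : B) (F : lcosets H) :
  lcoset b (val F) \in lcosets H.
Proof.
case: F => F /= /set_mem[c _ <-]; apply/mem_set; exists (b * c) => //.
rewrite /lcoset image_comp; apply: eq_imagel => x _ /=; exact/esym/mulgA.
Qed.

Definition lcoset_act (b : B) (F : lcosets H) : lcosets H :=
  exist _ (lcoset b (val F)) (lcoset_act_subproof b F).

Lemma lcoset_act1 F : lcoset_act 1 F = F.
Proof.
apply: val_inj => /=; rewrite /lcoset.
by under eq_imagel do rewrite mul1g; rewrite image_id.
Qed.

Lemma lcoset_actM b c F : lcoset_act (b * c) F = lcoset_act b (lcoset_act c F).
Proof.
apply: val_inj => /=; rewrite /lcoset image_comp.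
by apply: eq_imagel => x _ /=; exact/esym/mulgA.
Qed.

Definition lcoset_action : setAction B (lcosets H) :=
  SetAction lcoset_act1 lcoset_actM.

Lemma base_coset_subproof : lcoset 1 H \in lcosets H.
Proof. by apply/mem_set; exists 1. Qed.

(** The coset [H] itself. *)
Definition base_coset : lcosets H := exist _ (lcoset 1 H) base_coset_subproof.

Lemma base_cosetE : val base_coset = H.
Proof.
by rewrite /= /lcoset; under eq_imagel do rewrite mul1g; rewrite image_id.
Qed.

Definition diagonals : set (set (lcosets H)) :=
  [set [set F.1; F.2] | F in [set F | F.1 <> F.2]].

Definition diagonal_class (S : set (lcosets H)) : set (set (lcosets H)) :=
  [set lcoset_act b @` S | b in [set: B]].

Definition diagonal_classes : set (set (set (lcosets H))) :=
  [set diagonal_class S | S in diagonals].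

Context (lam : diagonal_classes -> label).

(** For [F1 <> F2], [diagonal_class [set F1; F2]] is in [diagonal_classes], so
    that [insub] returns it and the label is its image by [lam]; the default
    value is used only if [F1 = F2]. *)
Definition diagonal_label (F1 F2 : lcosets H) : label :=
  if insub (diagonal_class [set F1; F2]) is Some c then lam c else label2.

Lemma diagonal_label_sym F1 F2 : diagonal_label F1 F2 = diagonal_label F2 F1.
Proof. by rewrite /diagonal_label setUC. Qed.

Definition diagonal_graph : coxeterGraph (lcosets H) :=
  CoxeterGraph diagonal_label_sym.

Lemma diagonal_graphE (F1 F2 : lcosets H) : F1 <> F2 ->
  exists p : diagonal_class [set F1; F2] \in diagonal_classes,
    diagonal_graph F1 F2 = lam (exist _ (diagonal_class [set F1; F2]) p).
Proof.
move=> F12; have p : diagonal_class [set F1; F2] \in diagonal_classes.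
  by apply/mem_set; exists [set F1; F2] => //; exists (F1, F2).
by exists p; rewrite /= /diagonal_label insubT.
Qed.

Lemma diagonal_graph_act b F1 F2 :
  diagonal_graph (lcoset_action b F1) (lcoset_action b F2) =
  diagonal_graph F1 F2.
Proof.
rewrite /= /diagonal_label; congr (if insub _ is Some c then lam c else _).
rewrite -image_set1 -[[set lcoset_act b F2]]image_set1 -image_setU.
apply/seteqP; split=> _ [c _ <-].
  exists (c * b) => //; rewrite image_comp.
  by apply: eq_imagel => F _ /=; rewrite lcoset_actM.
exists (c * b^-1) => //; rewrite image_comp.
by apply: eq_imagel => F _ /=; rewrite -lcoset_actM -mulgA mulVg mulg1.
Qed.

End Diagonals.

Arguments diagonal_classes {B} H.

(** * The extension of a Coxeter graph by another one

    The vertex set is [(VG \ {v}) + VD]: the common vertex is represented in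
    the second summand, by the distinguished vertex of [D]. *)

Section Extension.
Context {VG VD : choiceType} (v : VG).

Definition ext_vertex : choiceType := ({w : VG | w != v} + VD)%type.

(** The vertex of the extension which corresponds to a vertex of [G]; [vD] is
    the distinguished vertex of [D]. *)
Definition ext_inl (vD : VD) (w : VG) : ext_vertex :=
  if insub w is Some w' then inl w' else inr vD.

Context (G : coxeterGraph VG) (D : coxeterGraph VD).

Definition ext_label (x y : ext_vertex) : label :=
  match x, y with
  | inl w, inl w' => G (val w) (val w')
  | inl w, inr _ | inr _, inl w => G (val w) v
  | inr F, inr F' => D F F'
  end.

Lemma ext_label_sym x y : ext_label x y = ext_label y x.
Proof. by case: x y => [x|x] [y|y] //=; exact: cox_label_sym. Qed.

Definition ext_graph : coxeterGraph ext_vertex := CoxeterGraph ext_label_sym.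

Context {B : groupType} (a : setAction B VD).

Definition ext_act (b : B) (x : ext_vertex) : ext_vertex :=
  match x with inl w => inl w | inr F => inr (a b F) end.

Lemma ext_act1 x : ext_act 1 x = x.
Proof. by case: x => //= F; rewrite sact1. Qed.

Lemma ext_actM b c x : ext_act (b * c) x = ext_act b (ext_act c x).
Proof. by case: x => //= F; rewrite sactM. Qed.

Definition ext_action : setAction B ext_vertex := SetAction ext_act1 ext_actM.

Lemma ext_graph_act : (forall b s t, D (a b s) (a b t) = D s t) ->
  forall b s t, ext_graph (ext_action b s) (ext_action b t) = ext_graph s t.
Proof. by move=> aD b [s|s] [t|t] //=; exact: aD. Qed.

End Extension.

Arguments ext_vertex {VG} VD v.

(** * Twisting

    [A] and [B] come with families of maximal parabolic subgroups indexed by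
    [V] and [I]; [B] acts on [V] by [a] and on [A] by [eta], and [F] chooses a
    vertex in each orbit.  A subset [X] of [A] and a subset [Y] of [B] give the
    subset [X `*` Y] of the semidirect product, which is a pair type. *)

Section Twisting.
Context {V I : Type} {A B : groupType} (PA : V -> set A) (PB : I -> set B).
Context (a : setAction B V) (eta : autAction B A) (F : orbits a -> V).

Definition cap_parabolic (J : set V) : set A := \bigcap_(s in J) PA s.

Definition twisting_parabolic (t : I + orbits a) : set (sdprod eta) :=
  match t with
  | inl i =>
      cap_parabolic
        (\bigcup_(L in [set: orbits a])
           (val L `\` [set a b (F L) | b in PB i])) `*` PB i
  | inr L => cap_parabolic (val L) `*` [set: B]
  end.

Definition twisting : incidenceSystem (I + orbits a) :=
  coset_system twisting_parabolic.

End Twisting.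

(** * The data associated with [G] and a polytope [beta]

    [G] is a Coxeter graph with vertices [0, ..., m], [m] being the
    distinguished one, and [beta] is of rank [n.+1], with automorphism group
    [B] and distinguished generators [rho]. *)

Section McMullenSchulte.
Context {m n : nat} (G : coxeterGraph 'I_m.+1).
Context {B : groupType} (rho : 'I_n.+1 -> B).

(** The stabilizer [B_0] of the base vertex. *)
Definition vertex_group : set B := parabolic rho ord0.

Context (lam : diagonal_classes vertex_group -> label).

Definition K_vertex : choiceType :=
  ext_vertex (lcosets vertex_group) (ord_max : 'I_m.+1).

Definition K_graph : coxeterGraph K_vertex :=
  ext_graph ord_max G (diagonal_graph lam).

Definition K_action : setAction B K_vertex :=
  ext_action ord_max (lcoset_action vertex_group).

(** The vertex [B_0] of [D], identified with the last vertex of [G]. *)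
Definition K_base : K_vertex := inr (base_coset vertex_group).

Definition K_inl (i : 'I_m.+1) : K_vertex :=
  ext_inl ord_max (base_coset vertex_group) i.

Lemma K_inl_max : K_inl ord_max = K_base.
Proof. by rewrite /K_inl /ext_inl insubF ?eqxx. Qed.

Definition K_eta : autAction B (coxeter K_graph) :=
  coxeter_action (a := K_action)
    (ext_graph_act (v := ord_max) G (diagonal_graph_act lam)).

Definition ms_gen (k : 'I_(m.+1 + n.+1)) : sdprod K_eta :=
  match fintype.split k with
  | inl i => (cox_gen K_graph (K_inl i), 1)
  | inr i => (1, rho i)
  end.

Definition ms_polytope : incidenceSystem 'I_(m.+1 + n.+1) :=
  polytope_system ms_gen.

(** The correspondence between the ranks of the McMullen-Schulte polytope and
    the types of the twisting. *)
Definition ms_type (k : 'I_(m.+1 + n.+1)) : 'I_n.+1 + orbits K_action :=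
  match fintype.split k with
  | inl i => inr (orbit_of K_action (K_inl i))
  | inr i => inl i
  end.

Definition K_twisting (F : orbits K_action -> K_vertex) :
    incidenceSystem ('I_n.+1 + orbits K_action) :=
  twisting (parabolic (cox_gen K_graph)) (parabolic rho) K_eta F.

End McMullenSchulte.

(* Main.v *)
Require Import Defs.
From mathcomp Require Import all_boot all_order all_algebra algC cyclotomic.
From mathcomp Require Import boolp classical_sets functions cardinality.
From mathcomp Require Import ring.

Set Implicit Arguments.
Unset Strict Implicit.
Unset Printing Implicit Defensive.

(** The isomorphism is the identity on cosets.  Both systems are coset systems
    of the same group [A ><| B], with [A] the Coxeter group of the extension
    [K], so it is enough that corresponding types have the same parabolic
    subgroup, and that [ms_type] is a bijection (the orbits of [B] on the
    vertices of [K] are the fibres of [vertex_index], and [K_inl] meets each of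
    them exactly once).

    Fix a rank [k].  The generators of the group which omits [tau_k] are
    generators [a_s] of [A] and generators of [B]; if [H] is the subgroup of
    [B] generated by the latter, conjugation by [H] shows that the whole
    subgroup is [N `*` H], with [N] generated by the [a_(b s)] for [b] in [H]
    ([sdprod_generated], [ms_parabolicE]).  Hence [N] is a standard parabolic
    subgroup of [A], generated by the [a_t] for [t] outside some set [J] of
    vertices.  When [k] comes from a vertex of [G], [H] is all of [B] and [J]
    is the orbit of this vertex; when [k] comes from a rank [i] of the second
    polytope, [H] is [B_i], and [J] consists of the vertices which are outside
    [B_i F_L], [L] being their orbit, since [F_L] is the vertex [K_inl]
    chosen in [L] ([representativeE]).

    The twisting uses the same set [J], but as the intersection of the
    maximal parabolic subgroups [A_s] with [s] in [J].  The remaining point is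
    therefore the theorem that an intersection of standard parabolic subgroups
    of a Coxeter group is the standard parabolic subgroup on the intersection
    of the sets of generators ([bigcap_generated]).  It is proved by descent on
    the length.  If [s] is the last letter of a shortest word for [w], then
    [a_s] is an inversion of [w], which is a property of the element [w] and
    not of the word; so any word for [w] contains a letter [r] such that [a_s]
    is conjugate to [a_r] by a suffix of that word.  If [w] is in the parabolic
    subgroup on [I], this puts [a_s] in that subgroup, whence [s] is in [I],
    and [w a_s] is a shorter element of the intersection.

    Two actions of the Coxeter group are used.  That inversions are well
    defined comes from the action on pairs of an element and a sign
    ([parity_step]).  That [a_s] is in the parabolic subgroup on [I] only if
    [s] is in [I] comes from the contragredient of the geometric
    representation ([cox_gen_parabolic]): a functional which is supported at
    [s] is fixed by the other generators but not by [a_s]. *)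

Import GRing.Theory.
Local Open Scope classical_set_scope.

(** * Generated subgroups *)

Section GeneratedSubgroup.
Context {G : groupType}.
Local Open Scope group_scope.
Implicit Types (S H : set G).

Lemma subgroup1 H : is_subgroup H -> H 1.
Proof. by case. Qed.

Lemma subgroupV H x : is_subgroup H -> H x -> H x^-1.
Proof. by case=> H1 HV Hx; rewrite -[x^-1]mul1g; exact: HV. Qed.

Lemma subgroupM H x y : is_subgroup H -> H x -> H y -> H (x * y).
Proof.
by move=> sH Hx /(subgroupV sH) Hy; rewrite -[y]invgK; apply: sH.2.
Qed.

Lemma generated_subgroup S : is_subgroup (generated S).
Proof.
split=> [H [[]]//|x y Sx Sy H HS].
by case: (HS) => -[_ HV] _; apply: HV; [exact: Sx | exact: Sy].
Qed.

Lemma sub_generated S : S `<=` generated S.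
Proof. exact: sub_gen_smallest. Qed.

Lemma generated_sub S H : is_subgroup H -> S `<=` H -> generated S `<=` H.
Proof. exact: smallest_sub. Qed.

End GeneratedSubgroup.

(** * Actions of a Coxeter group *)

Section CoxeterAction.
Context {V : choiceType} (K : coxeterGraph V) {X : Type} (g : V -> X -> X).
Hypothesis gK : forall s, involutive (g s).
Hypothesis g_braid : forall s t k, s <> t -> label_val (K s t) = Some k ->
  forall x, iter k (g s \o g t) x = x.
Local Open Scope group_scope.

Definition word_fold (u : word V) (x : X) : X :=
  foldr (fun l : V * bool => g l.1) x u.

Lemma word_fold_cat u v x : word_fold (u ++ v) x = word_fold u (word_fold v x).
Proof. exact: foldr_cat. Qed.

Lemma word_fold_equiv u v : word_equiv (cox_relator K) u v ->
  word_fold u =1 word_fold v.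
Proof.
elim=> {u v} [//|u v _ IH x|u v w _ IH1 _ IH2 x|u u' v v' _ IH1 _ IH2 x|s e x|].
- by rewrite IH.
- by rewrite IH1.
- by rewrite !word_fold_cat IH2 IH1.
- exact: gK.
- move=> u [s x|s t k st stk x]; first exact: gK.
  rewrite -[RHS](g_braid st stk); elim: (k) => //= j IH.
  by rewrite IH.
Qed.

(** Evaluating on the chosen representative of [w] makes this an action because
    [word_fold] only depends on the class of the word. *)
Definition cox_act (w : coxeter K) : X -> X := word_fold (repr w).

Lemma cox_act_class u :
  cox_act (word_class (cox_relator K) u) =1 word_fold u.
Proof. by apply: word_fold_equiv; exact: repr_word_class. Qed.

Lemma cox_act1 x : cox_act 1 x = x.
Proof. exact: cox_act_class. Qed.

Lemma cox_actM v w x : cox_act (v * w) x = cox_act v (cox_act w x).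
Proof. by rewrite [LHS]cox_act_class word_fold_cat. Qed.

Lemma cox_act_gen s x : cox_act (cox_gen K s) x = g s x.
Proof. exact: cox_act_class. Qed.

End CoxeterAction.

(** * Words in the generators *)

Section CoxeterWords.
Context {V : choiceType} (K : coxeterGraph V).
Local Open Scope group_scope.
Local Notation "u %:W" := (\prod_(s <- u) cox_gen K s) (at level 2).

Lemma cox_gen_sq s : cox_gen K s * cox_gen K s = 1.
Proof.
by rewrite [LHS]presented_mulE; apply/word_classP/we_relator/cox_square.
Qed.

Lemma cox_genV s : (cox_gen K s)^-1 = cox_gen K s.
Proof. exact/mulg1_eq/cox_gen_sq. Qed.

Lemma cox_gen_braid s t k : s <> t -> label_val (K s t) = Some k ->
  (cox_gen K s * cox_gen K t) ^+ k = 1.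
Proof.
move=> st stk; transitivity
  (word_class (cox_relator K) (flatten (nseq k [:: (s, false); (t, false)]))).
  elim: (k) => // j IH; rewrite expgS IH.
  rewrite [cox_gen K s * _]presented_mulE [LHS]presented_mulE //.
by apply/word_classP/we_relator/cox_braid.
Qed.

Lemma cox_wordP w : exists u, w = u%:W.
Proof.
rewrite -[w]word_class_repr; elim: (repr w) => [|[s e] u [v IH]].
  by exists [::]; rewrite big_nil.
exists (s :: v); rewrite big_cons -IH.
suff -> : cox_gen K s = word_class (cox_relator K) [:: (s, e)].
  exact/esym/presented_mulE.
case: e => //; rewrite -cox_genV; exact: presented_invE.
Qed.

Lemma generated_wordP (J : set V) w : generated (cox_gen K @` J) w ->
  exists2 u : seq V, [set` u] `<=` J & w = u%:W.
Proof.
pose H := [set w | exists2 u : seq V, [set` u] `<=` J & w = u%:W].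
suff HS : is_subgroup H.
  apply: (generated_sub HS) => _ [s Js <-].
  exists [:: s]; last by rewrite big_seq1.
  by move=> t /=; rewrite inE => /eqP ->.
split; first by exists [::] => //; rewrite big_nil.
move=> _ _ [u uJ ->] [v vJ ->]; exists (u ++ rev v).
  by move=> s; rewrite /= mem_cat mem_rev => /orP[/uJ|/vJ].
rewrite big_cat; congr (_ * _).
elim: v {vJ} => [|s v IH]; first by rewrite !big_nil invg1.
by rewrite rev_cons -cats1 big_cat big_seq1 big_cons invgM IH cox_genV.
Qed.

Lemma word_generated (J : set V) u : [set` u] `<=` J ->
  generated (cox_gen K @` J) (u%:W).
Proof.
have sJ := generated_subgroup (cox_gen K @` J).
elim: u => [|s u IH] uJ; first by rewrite big_nil; exact: subgroup1.
rewrite big_cons; apply: (subgroupM sJ).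
  by apply: sub_generated; exists s => //; apply: uJ; rewrite /= mem_head.
by apply: IH => t tu; apply: uJ; rewrite /= inE; apply/orP; right.
Qed.

End CoxeterWords.

(** * The geometric representation *)

Section LabelCoefficient.
Local Open Scope ring_scope.

(** The sequences [z] record the coordinates met by a vector when two
    reflections are applied alternately, [c] being the corresponding entry of
    the Cartan matrix.  The classical choice [c = - 2 cos (pi / k)] is
    [- (q + q^-1)] for [q = exp (i pi / k)], and any primitive [2 k]-th root of
    unity [q] serves as well.  The solutions of the recurrence are the
    combinations of the powers of [q] and of [q^-1], so that the sum is made of
    geometric sums over all the [k]-th roots of unity. *)
Lemma dihedral_coef (l : label) : exists c : algC,
  forall k, label_val l = Some k -> forall z : nat -> algC,
  (forall j, z j.+2 = - c * z j.+1 - z j) -> \sum_(j < k) z j.*2 = 0.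
Proof.
case: l => -[k|] /= k2; last by exists 0.
have k2_gt0 : (0 < k.*2)%N by rewrite double_gt0; exact: ltnW.
have [q q_prim] := C_prim_root_exists k2_gt0.
have q0 : q != 0 by rewrite (prim_root_eq0 q_prim) -lt0n.
have qk : (q ^+ 2) ^+ k = 1 by rewrite -exprM mul2n prim_expr_order.
have qV : q * q^-1 = 1 by rewrite divff.
have q2 : q ^+ 2 - 1 != 0.
  rewrite subr_eq0 -(prim_order_dvd q_prim) gtnNdvd //.
  by rewrite -muln2 ltn_Pmull.
exists (- (q + q^-1)) => _ [<-] z zE.
have PE j : z j.+1 - q^-1 * z j = q ^+ j * (z 1%N - q^-1 * z 0%N).
  elim: j => [|j IH]; first by rewrite mul1r.
  by rewrite exprS -mulrA -IH zE; ring: qV.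
have QE j : z j.+1 - q * z j = q^-1 ^+ j * (z 1%N - q * z 0%N).
  elim: j => [|j IH]; first by rewrite mul1r.
  by rewrite exprS -mulrA -IH zE; ring: qV.
have geom (r : algC) : r ^+ 2 - 1 != 0 -> (r ^+ 2) ^+ k = 1 ->
    \sum_(j < k) r ^+ j.*2 = 0.
  move=> r2 rk; apply: (mulfI r2); rewrite mulr0.
  under eq_bigr do rewrite -mul2n exprM.
  by rewrite -subrX1 rk subrr.
have q2V : q^-1 ^+ 2 - 1 != 0.
  by rewrite subr_eq0 exprVn invr_eq1 -subr_eq0.
(* [(q - q^-1) z_j] is the difference of the two geometric sequences above. *)
apply: (mulfI (_ : q - q^-1 != 0)).
  apply: contraNneq q2 => qq; apply/eqP; rewrite -[RHS](mulr0 q) -qq.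
  by ring: qV.
rewrite mulr0 mulr_sumr.
under eq_bigr => j _.
  rewrite (_ : _ * _ = (z j.*2.+1 - q^-1 * z j.*2) - (z j.*2.+1 - q * z j.*2));
    last by ring.
  rewrite PE QE; over.
rewrite big_split /= sumrN -!mulr_suml !geom ?mul0r ?subrr //.
by rewrite !exprVn qk invr1.
Qed.

(** The root of unity is chosen from the label alone, which makes the Cartan
    matrix symmetric. *)
Definition label_coef (l : label) : algC := projT1 (cid (dihedral_coef l)).

Lemma label_coefP (l : label) k : label_val l = Some k ->
  forall z : nat -> algC,
  (forall j, z j.+2 = - label_coef l * z j.+1 - z j) ->
  \sum_(j < k) z j.*2 = 0.
Proof. exact: (projT2 (cid (dihedral_coef l))). Qed.

End LabelCoefficient.

Section GeometricRepresentation.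
Context {V : choiceType} (K : coxeterGraph V).
Local Open Scope ring_scope.

Definition cartan (s t : V) : algC := if s == t then 2 else label_coef (K s t).

Lemma cartan_sym s t : cartan s t = cartan t s.
Proof. by rewrite /cartan eq_sym cox_label_sym. Qed.

(** The action contragredient to the geometric representation; its point is that
    the functions which vanish at [s] are fixed. *)
Definition coreflection (s : V) (f : V -> algC) : V -> algC :=
  fun t => f t - cartan s t * f s.

Lemma coreflection_self s f : coreflection s f s = - f s.
Proof. by rewrite /coreflection /cartan eqxx; ring. Qed.

Lemma coreflectionK s : involutive (coreflection s).
Proof.
move=> f; apply/funext => t.
by rewrite {1}/coreflection coreflection_self /coreflection; ring.
Qed.

(** Each application of the product of two reflections subtracts from [f u] a
    multiple of its value at [t], then a multiple of the new value at [s].  The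
    total change after [k] rounds is given by the sums of these values, which
    vanish by [label_coefP]. *)
Lemma coreflection_braid s t k : s <> t -> label_val (K s t) = Some k ->
  forall f, iter k (coreflection s \o coreflection t) f = f.
Proof.
move=> /eqP st stk f; pose F j := iter j (coreflection s \o coreflection t) f.
have FS j u : F j.+1 u =
    F j u - cartan t u * F j t - cartan s u * coreflection t (F j) s.
  by [].
pose z n := if odd n then coreflection t (F n./2) s else F n./2 t.
have zev j : z j.*2 = F j t by rewrite /z odd_double doubleK.
have zod j : z j.*2.+1 = coreflection t (F j) s.
  by rewrite /z /= odd_double uphalf_double.
have cst : cartan s t = label_coef (K s t) by rewrite /cartan (negPf st).
have cts : cartan t s = label_coef (K s t) by rewrite cartan_sym.
have tt : cartan t t = 2 by rewrite /cartan eqxx.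
have zE n : z n.+2 = - label_coef (K s t) * z n.+1 - z n.
  rewrite -(odd_double_half n); case: (odd n); rewrite ?add1n ?add0n -?doubleS.
    have FSs j : F j.+1 s = - coreflection t (F j) s.
      exact: coreflection_self.
    by rewrite zev !zod {1}/coreflection FSs cts; ring.
  by rewrite zod !zev FS cst tt; ring.
(* The odd terms satisfy the same recurrence, after a shift. *)
have z1E n : z n.+3 = - label_coef (K s t) * z n.+2 - z n.+1 by [].
have := label_coefP stk z1E; have := label_coefP stk zE.
move=> ev od; apply/funext => u; rewrite -/(F k).
suff -> : F k u = f u - cartan t u * (\sum_(j < k) z j.*2)
                    - cartan s u * (\sum_(j < k) z j.*2.+1).
  by rewrite ev od; ring.
elim: (k) => [|j IH]; first by rewrite !big_ord0 !mulr0 !subr0.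
by rewrite FS IH !big_ord_recr /= zev zod; ring.
Qed.

Local Notation geom_act := (cox_act (K := K) coreflection).

(** The indicator function of [s] is fixed by all the generators except that of
    [s], which changes its sign.  In particular distinct vertices give distinct
    generators. *)
Lemma cox_gen_parabolic (J : set V) s :
  generated (cox_gen K @` J) (cox_gen K s) -> J s.
Proof.
move=> Js; apply/not_notP => nJs.
have actM := cox_actM coreflectionK coreflection_braid.
have act1 := cox_act1 coreflectionK coreflection_braid.
have actg := cox_act_gen coreflectionK coreflection_braid.
pose f t : algC := (s == t)%:R.
suff /(_ _ Js)/(congr1 (fun h => h s)) :
    generated (cox_gen K @` J) `<=` [set w | geom_act w f = f].
  rewrite actg coreflection_self /f eqxx => /eqP.
  by rewrite eq_sym -subr_eq0 opprK -mulr2n Num.Theory.pnatr_eq0.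
apply: generated_sub.
  split=> [|x y /= xf yf]; first exact: act1.
  by rewrite -{1}yf -actM mulgVK.
move=> _ [t Jt <-] /=; rewrite actg; apply/funext => u.
rewrite /coreflection {2}/f; case: eqP => [st|_]; last by rewrite mulr0 subr0.
by case: nJs; rewrite st.
Qed.

End GeometricRepresentation.

(** * Inversions and intersections of parabolic subgroups *)

Section ReflectionParity.
Context {V : choiceType} (K : coxeterGraph V).
Local Open Scope group_scope.
Local Notation a := (cox_gen K).
Local Notation "u %:W" := (\prod_(s <- u) a s) (at level 2).

(** The action of Tits on reflections with signs, extended to all the elements
    of the group so that reflections need not be singled out. *)
Definition parity_step (s : V) (p : coxeter K * bool) : coxeter K * bool :=
  (a s * p.1 * a s, p.2 (+) (p.1 == a s)).

Lemma parity_stepK s : involutive (parity_step s).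
Proof.
case=> x e; rewrite /parity_step /=; congr (_, _).
  by rewrite -!mulgA cox_gen_sq mulg1 mulgA cox_gen_sq mul1g.
rewrite (_ : (a s * x * a s == a s) = (x == a s)) ?addbK //.
rewrite -{3}(mulgK (a s) (a s)) cox_genV (inj_eq (mulIg _)).
by rewrite (inj_eq (mulgI _)).
Qed.

(** With [d = a_s a_t], the sign of [x] changes once for each [i < 2 k] such
    that [x = d ^- i a_t].  As [d ^+ k = 1], the indices [i] and [i + k] contribute
    equally, and the total is even. *)
Lemma parity_step_braid s t k : s <> t -> label_val (K s t) = Some k ->
  forall p, iter k (parity_step s \o parity_step t) p = p.
Proof.
move=> st stk [x e]; pose d := a s * a t.
have dk : d ^+ k = 1 by exact: cox_gen_braid stk.
have tV n : d ^- n = a t * d ^+ n * a t.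
  rewrite -{1}cox_genV -mulgA -conjgE conjXg -expVgn; congr (_ ^+ _).
  by rewrite conjgE invgM !cox_genV /d -!mulgA cox_gen_sq mulg1.
have tdV n : d ^- n * a t = a t * d ^+ n.
  by rewrite tV -!mulgA cox_gen_sq mulg1.
suff E j : iter j (parity_step s \o parity_step t) (x, e) =
    (d ^+ j * x * d ^- j,
     e (+) odd (count (fun i => x == d ^- i * a t) (iota 0 j.*2))).
  rewrite E dk mul1g invg1 mulg1 -addnn iotaD count_cat add0n.
  have := iotaDl k 0 k; rewrite addn0 => ->; rewrite count_map.
  rewrite (@eq_count _ (preim _ _) (fun i => x == d ^- i * a t)).
    by rewrite addnn odd_double addbF.
  by move=> i /=; rewrite expgnDr dk mul1g.
elim: j => [|j IH]; first by rewrite /= expg0 invg1 mul1g mulg1 addbF.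
rewrite iterS IH doubleS -addn2 iotaD count_cat /parity_step /=; congr (_, _).
  rewrite expgS invgM [d^-1]invgM !cox_genV /d -!mulgA; congr (_ * _).
rewrite oddD /= addn0 oddD !oddb !addbA add0n.
congr (_ (+) _ (+) _).
  have tE : a t = d ^+ j * (d ^- j.*2 * a t) * d ^- j.
    by rewrite -addnn expgnDr invgM !mulgA mulgV mul1g tdV mulgK.
  by rewrite [in LHS]tE (inj_eq (mulIg _)) (inj_eq (mulgI _)).
have sE : a s = a t * (d ^+ j * (d ^- j.*2.+1 * a t) * d ^- j) * a t.
  rewrite -addnn -addSn expgnDr invgM !mulgA -[a t * d ^+ j * d ^- j]mulgA.
  rewrite mulgV mulg1 -[a t * d ^- j.+1 * a t]mulgA tdV expgS !mulgA mulgK.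
  by rewrite cox_gen_sq mul1g -mulgA cox_gen_sq mulg1.
by rewrite {1}sE (inj_eq (mulIg _)) (inj_eq (mulgI _)) (inj_eq (mulIg _))
  (inj_eq (mulgI _)).
Qed.

(** The parity of the number of factorizations [u = u1 ++ s :: u2] such that [x]
    is the conjugate of [a_s] by [u2]. *)
Definition word_parity (u : seq V) (x : coxeter K) : bool :=
  (foldr parity_step (x, false) u).2.

Lemma foldr_parity_step u x e :
  foldr parity_step (x, e) u = (u%:W * x * (u%:W)^-1, e (+) word_parity u x).
Proof.
elim: u e => [|s u IH] e.
  by rewrite big_nil invg1 mul1g mulg1 addbF.
rewrite /word_parity /= !IH /parity_step /= big_cons invgM cox_genV.
by rewrite !mulgA addbA.
Qed.

(** Parities are read off an action of the group, so they are invariants of the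
    element: this is what transfers information from one word to another. *)
Lemma word_parity_equiv u v : u%:W = v%:W -> word_parity u =1 word_parity v.
Proof.
suff actE w x : word_parity w x = (cox_act parity_step (w%:W) (x, false)).2.
  by move=> uv x; rewrite !actE uv.
congr snd; elim: w => [|s w IH].
  by rewrite big_nil (cox_act1 parity_stepK parity_step_braid).
rewrite big_cons (cox_actM parity_stepK parity_step_braid).
by rewrite (cox_act_gen parity_stepK parity_step_braid) -IH.
Qed.

Lemma word_parity_rcons u s :
  word_parity (rcons u s) (a s) = ~~ word_parity u (a s).
Proof.
rewrite {1}/word_parity foldr_rcons {2}/parity_step /= eqxx cox_gen_sq mul1g.
by rewrite foldr_parity_step.
Qed.

(** If the parity is odd, the sign changes at some letter [s]. *)
Lemma word_parity_split u x : word_parity u x ->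
  exists u1 s u2, u = u1 ++ s :: u2 /\ x = (u2%:W)^-1 * a s * u2%:W.
Proof.
elim: u => // s u IH; rewrite {1}/word_parity /= foldr_parity_step /=.
have [/IH[u1 [r [u2 [-> ->]]]] _|_ /eqP us] := boolP (word_parity u x).
  by exists (s :: u1), r, u2.
exists [::], s, u; split=> //.
by rewrite -us -!mulgA mulVg mulg1 mulKg.
Qed.

(** The exchange condition: multiplying by [u2^-1 s u2] on the right removes the
    letter [s] in front of [u2]. *)
Lemma word_deletion u x : word_parity u x ->
  exists2 v : seq V, (size v < size u)%N & u%:W * x = v%:W.
Proof.
move=> /word_parity_split[u1 [s [u2 [-> ->]]]]; exists (u1 ++ u2).
  by rewrite !size_cat ltn_add2l.
rewrite !big_cat big_cons /= -!mulgA mulVKg; congr (_ * _).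
by rewrite mulgA cox_gen_sq mul1g.
Qed.

Lemma parity_generated (J : set V) u x : [set` u] `<=` J ->
  word_parity u x -> generated (a @` J) x.
Proof.
move=> uJ /word_parity_split[u1 [s [u2 [uE ->]]]].
have sJ := generated_subgroup (a @` J).
have u2J : generated (a @` J) (u2%:W).
  apply: word_generated => t tu; apply: uJ.
  by rewrite /= uE mem_cat inE [t \in u2]tu !orbT.
apply: (subgroupM sJ) => //; apply: (subgroupM sJ); first exact: (subgroupV sJ).
apply: sub_generated; exists s => //; apply: uJ.
by rewrite /= uE mem_cat mem_head orbT.
Qed.

(** The last letter of a shortest word for [w] is an inversion of [w]; read on a
    word over [J i], this inversion is in the subgroup generated by [J i], so
    that the letter is in every [J i] and can be removed. *)
Lemma bigcap_generated (I : Type) (D : set I) (J : I -> set V) :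
  \bigcap_(i in D) generated (a @` J i) =
  generated (a @` (\bigcap_(i in D) J i)).
Proof.
apply/seteqP; split; last first.
  move=> w wD i Di; apply: generated_sub wD; first exact: generated_subgroup.
  by move=> _ [s sJ <-]; apply: sub_generated; exists s => //; exact: sJ.
have sJ := generated_subgroup (a @` (\bigcap_(i in D) J i)).
move=> w; have [u ->] := cox_wordP w.
have [n] := ubnP (size u); elim: n u => // n IH u un uD.
have [[v vu uv]|umin] :=
    pselect (exists2 v : seq V, (size v < size u)%N & u%:W = v%:W).
  by rewrite uv; apply: IH; [exact: leq_trans vu _ | rewrite -uv].
case/lastP: u => [|u s] in un uD umin *.
  by rewrite big_nil; exact: subgroup1.
have usE : (rcons u s)%:W = u%:W * a s by rewrite -cats1 big_cat big_seq1.
(* Otherwise [a_s] is an inversion of [u], and multiplying [u] by [a_s] gives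
   back [rcons u s] with a word shorter than [u]. *)
have us : word_parity (rcons u s) (a s).
  rewrite word_parity_rcons; apply/negP => /word_deletion[v vu uv].
  apply: umin; exists v; last by rewrite usE.
  by rewrite size_rcons ltnS ltnW.
have sD : (\bigcap_(i in D) J i) s.
  move=> i Di; apply: (@cox_gen_parabolic _ K).
  have [v vJ uv] := generated_wordP (uD i Di).
  by apply: (parity_generated vJ); rewrite -(word_parity_equiv uv).
have aD : generated (a @` (\bigcap_(i in D) J i)) (a s).
  by apply: sub_generated; exists s.
rewrite usE; apply: (subgroupM sJ) => //; apply: IH.
  by rewrite size_rcons in un.
move=> i Di; have siJ := generated_subgroup (a @` J i).
rewrite -[u%:W](mulgK (a s)) -usE; apply: siJ.2; first exact: uD.
by apply: sub_generated; exists s => //; exact: sD.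
Qed.

End ReflectionParity.

(** * Generators of a semidirect product *)

Section SemidirectGenerated.
Context {B A : groupType} (eta : autAction B A).
Local Open Scope group_scope.

Definition sdleft (x : A) : sdprod eta := (x, 1).
Definition sdright (b : B) : sdprod eta := (1, b).

Lemma autactV b x : eta b x^-1 = (eta b x)^-1.
Proof. by apply/esym/mulg1_eq; rewrite -autact_mul mulgV autact_one. Qed.

Lemma sdprod_pairE (x : A) (b : B) :
  (x, b) = sdleft x * sdright b :> sdprod eta.
Proof. by congr (_, _); rewrite /= ?autact1 ?mulg1 ?mul1g. Qed.

Lemma sdleft_act b x : sdleft (eta b x) = sdright b * sdleft x * sdright b^-1.
Proof. by congr (_, _); rewrite /= ?autact_one ?mul1g ?mulg1 ?mulgV. Qed.

Lemma sdleftF x y : sdleft (x * y^-1) = sdleft x * (sdleft y)^-1.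
Proof. by congr (_, _); rewrite /= ?invg1 ?autact1 ?mulg1. Qed.

Lemma sdrightF b c : sdright (b * c^-1) = sdright b * (sdright c)^-1.
Proof. by congr (_, _); rewrite /= ?invg1 ?autact_one ?mulg1. Qed.

(** Moving the generators of [B] to the right conjugates those of [A], hence the
    orbits under the subgroup [generated SB]. *)
Lemma sdprod_generated (SA : set A) (SB : set B) :
  generated (sdleft @` SA `|` sdright @` SB) =
  generated [set eta b x | b in generated SB & x in SA] `*` generated SB
    :> set (sdprod eta).
Proof.
set N := [set eta b x | b in _ & x in _]; set H := generated _.
have sN := generated_subgroup N; have sB := generated_subgroup SB.
have sH : is_subgroup H := generated_subgroup _.
have N_act b x : generated SB b -> generated N x -> generated N (eta b x).
  move=> Bb; apply: (generated_sub (H := [set x | generated N (eta b x)])).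
    split=> [|y z /= Ny Nz]; first by rewrite /= autact_one; exact: subgroup1.
    by rewrite autact_mul autactV; apply: sN.2.
  move=> _ [c Bc [y SAy <-]] /=; rewrite -autactM; apply: sub_generated.
  by exists (b * c); [exact: (subgroupM sB) | exists y].
apply/seteqP; split.
  apply: generated_sub.
    split=> [|[x b] [y c] /= [Nx Bb] [Ny Bc]].
      by split; exact: subgroup1.
    split=> /=; last exact: sB.2.
    apply: (subgroupM sN) => //; rewrite -autactM.
    apply: N_act; first exact: sB.2.
    exact: (subgroupV sN).
  move=> _ [[x SAx <-]|[b SBb <-]]; split=> /=.
  - apply: sub_generated; exists 1; first exact: subgroup1.
    by exists x => //; exact: autact1.
  - exact: subgroup1.
  - exact: subgroup1.
  - exact: sub_generated.
have HB b : generated SB b -> H (sdright b).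
  apply: (generated_sub (H := sdright @^-1` H)) => [|c SBc].
    split=> [|c d /= Hc Hd]; first exact: (subgroup1 sH).
    by rewrite sdrightF; apply: sH.2.
  by apply: sub_generated; right; exists c.
case=> x b [/= Nx Bb]; rewrite sdprod_pairE.
apply: (subgroupM sH); last exact: HB.
apply: (generated_sub (H := sdleft @^-1` H)) Nx => [|_ [c Bc [y SAy <-]]].
  split=> [|y z /= Hy Hz]; first exact: (subgroup1 sH).
  by rewrite sdleftF; apply: sH.2.
rewrite /= sdleft_act; apply: (subgroupM sH).
  apply: (subgroupM sH); first exact: HB.
  by apply: sub_generated; left; exists y.
by apply: HB; exact: (subgroupV sB).
Qed.

End SemidirectGenerated.

(** * Isomorphisms of coset systems *)

Section CosetSystemIsomorphism.
Context {G : groupType}.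

(** The types of the cosets depend on [i], so equality of the dependent pairs
    has to be reduced to that of the underlying sets. *)
Lemma coset_elt_eq (I : Type) (H : I -> set G) (x y : {i : I & lcosets (H i)}) :
  tag x = tag y -> val (tagged x) = val (tagged y) -> x = y.
Proof.
case: x y => i x [j y] /= ij; case: _ / ij in y *.
by move=> /val_inj ->.
Qed.

Lemma coset_system_isomorphic (I J : Type) (phi : I -> J)
    (H : I -> set G) (H' : J -> set G) :
  bijective phi -> (forall i, H i = H' (phi i)) ->
  isomorphic_along phi (coset_system H) (coset_system H').
Proof.
move=> phi_bij HH'; split=> //; case: phi_bij => psi phiK psiK.
have fwd i X : X \in lcosets (H i) -> X \in lcosets (H' (phi i)) by rewrite HH'.
have bwd j X : X \in lcosets (H' j) -> X \in lcosets (H (psi j)).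
  by rewrite HH' psiK.
exists (fun x : {i : I & lcosets (H i)} =>
  existT (fun j => lcosets (H' j)) (phi (tag x))
    (exist _ (val (tagged x)) (fwd _ _ (valP (tagged x))))).
split=> //.
exists (fun y : {j : J & lcosets (H' j)} =>
  existT (fun i => lcosets (H i)) (psi (tag y))
    (exist _ (val (tagged y)) (bwd _ _ (valP (tagged y))))) => x.
  by apply: coset_elt_eq => //=; exact: phiK.
by apply: coset_elt_eq => //=; exact: psiK.
Qed.

End CosetSystemIsomorphism.

(** * Vertices and orbits of the extension *)

Lemma split_lshift p q (i : 'I_p) : fintype.split (lshift q i) = inl i.
Proof. exact: (unsplitK (inl i)). Qed.

Lemma split_rshift p q (i : 'I_q) : fintype.split (rshift p i) = inr i.
Proof. exact: (unsplitK (inr i)). Qed.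

Section Vertices.
Context {m n : nat} {B : groupType} (rho : 'I_n.+1 -> B).
Local Open Scope group_scope.
Local Notation vertex := (K_vertex (m := m) rho).
Local Notation act := (K_action (m := m) rho).
Local Notation inK := (K_inl (m := m) rho).

(** The vertex of [G] under which a vertex of the extension lies, the second
    graph being collapsed to its base vertex: a complete invariant of the orbits
    of [B] (see [sorbitE]). *)
Definition vertex_index (s : vertex) : 'I_m.+1 :=
  if s is inl w then val w else ord_max.

Lemma vertex_index_act b s : vertex_index (act b s) = vertex_index s.
Proof. by case: s. Qed.

Lemma K_inl_val (w : {w : 'I_m.+1 | w != ord_max}) : inK (val w) = inl w.
Proof. by rewrite /K_inl /ext_inl valK. Qed.

Lemma vertex_indexK i : vertex_index (inK i) = i.
Proof.
rewrite /K_inl /ext_inl; case: insubP => [w _ //|].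
by rewrite negbK => /eqP.
Qed.

Lemma vertex_rep s : exists b, s = act b (inK (vertex_index s)).
Proof.
case: s => [w|[X XH]]; first by exists 1; rewrite K_inl_val.
have /set_mem[b _ bX] := XH; exists b.
rewrite K_inl_max; congr inr; apply: val_inj => /=.
by rewrite -bX -[X in lcoset b X]base_cosetE.
Qed.

Lemma sorbitE s : sorbit act s = [set t | vertex_index t = vertex_index s].
Proof.
apply/seteqP; split=> [_ [b _ <-]|t /= ts]; first exact: vertex_index_act.
have [b sE] := vertex_rep s; have [c tE] := vertex_rep t.
exists (c * b^-1) => //; rewrite {1}sE -sactM mulgVK.
by rewrite -ts -tE.
Qed.

Lemma orbit_index (L : orbits act) :
  exists i, L = orbit_of act (inK i).
Proof.
case: L => X XL; have /set_mem[s _ sX] := XL.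
exists (vertex_index s); apply: val_inj => /=.
by rewrite -sX !sorbitE vertex_indexK.
Qed.

Lemma orbit_of_inj : injective (fun i => orbit_of act (inK i)).
Proof.
move=> i j /(congr1 val) /=; rewrite !sorbitE !vertex_indexK => ij.
have := congr1 (fun S : set vertex => S (inK i)) ij.
by rewrite /= !vertex_indexK => <-.
Qed.

Lemma ms_type_bij : bijective (ms_type (m := m) rho).
Proof.
have idx L := cid (orbit_index L).
exists (fun t => match t with
  | inl i => rshift m.+1 i
  | inr L => lshift n.+1 (projT1 (idx L)) end).
  move=> k; rewrite /ms_type; case: (split_ordP k) => i ->.
    by case: idx => j /= /orbit_of_inj ->.
  by [].
case=> [i|L]; rewrite /ms_type ?split_rshift ?split_lshift //.
by case: idx => i /= <-.
Qed.

Section Representatives.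
Context (F : orbits act -> vertex).
Hypothesis F_mem : forall L, val L (F L).
Hypothesis F_base : forall L, val L = range inr -> F L = K_base rho.

(** The orbits of the vertices of [G] other than the last one are singletons, so
    that [F] has no choice there. *)
Lemma representativeE i : F (orbit_of act (inK i)) = inK i.
Proof.
set L := orbit_of _ _; have LE : val L = [set t | vertex_index t = i].
  by rewrite /= sorbitE vertex_indexK.
have [iE|im] := eqVneq i ord_max.
  rewrite iE K_inl_max; apply: F_base; rewrite LE iE.
  apply/seteqP; split=> [[w|X] /= tE|_ [X _ <-] /=] //; last by exists X.
  by have := valP w; rewrite /= tE eqxx.
have := F_mem L; rewrite LE /=; case: (F L) => [w <-|X iE] /=.
  by rewrite K_inl_val.
by rewrite -iE eqxx in im.
Qed.

End Representatives.

End Vertices.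

(** * Comparison of the parabolic subgroups *)

Section Parabolics.
Context {m n : nat} (G : coxeterGraph 'I_m.+1).
Context {B : groupType} (rho : 'I_n.+1 -> B).
Context (lam : diagonal_classes (vertex_group rho) -> label).
Local Open Scope group_scope.
Local Notation act := (K_action (m := m) rho).
Local Notation inK := (K_inl (m := m) rho).
Local Notation a := (cox_gen (K_graph G lam)).
Local Notation eta := (K_eta G lam).

Lemma cap_parabolicE (J : set (K_vertex (m := m) rho)) :
  cap_parabolic (parabolic a) J = generated (a @` (~` J)).
Proof.
transitivity (generated (a @` (\bigcap_(s in J) [set t | t <> s]))).
  exact: (@bigcap_generated _ _ _ J (fun s => [set t | t <> s])).
congr (generated (a @` _)); apply/seteqP; split=> [t tJ Jt|t nJt s Js ts].
  exact: (tJ t Jt).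
by apply: nJt; rewrite ts.
Qed.

Lemma K_eta_gen b s : eta b (a s) = a (act b s).
Proof.
exact: (coxeter_act_gen
  (ext_graph_act (v := ord_max) G (diagonal_graph_act lam))).
Qed.

Lemma ms_parabolicE k (H := generated
    [set rho i | i in [set i | rshift m.+1 i <> k]]) :
  parabolic (ms_gen G lam) k =
  generated (a @` [set act b (inK i) | b in H & i in
                     [set i | lshift n.+1 i <> k]]) `*` H.
Proof.
set P := [set i | lshift n.+1 i <> k].
set SA := [set a (inK i) | i in P].
set SB := [set rho i | i in [set i | rshift m.+1 i <> k]] in H *.
have -> : parabolic (ms_gen G lam) k =
    generated (sdleft eta @` SA `|` sdright eta @` SB).
  congr generated; apply/seteqP; split=> [_ [j jk <-]|x].
    rewrite /ms_gen; case: (split_ordP j) jk => i -> ik.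
      left; exists (a (inK i)) => //.
      by exists i.
    by right; exists (rho i) => //; exists i.
  case=> [[_ [i ik <-] <-]|[_ [i ik <-] <-]].
    by exists (lshift n.+1 i) => //; rewrite /ms_gen split_lshift.
  by exists (rshift m.+1 i) => //; rewrite /ms_gen split_rshift.
rewrite sdprod_generated; congr (generated _ `*` _).
apply/seteqP; split=> [_ [b Hb [_ [i Pi <-] <-]]|_ [_ [b Hb [i Pi <-] <-]]].
  rewrite K_eta_gen.
  exists (act b (inK i)) => //.
  by exists b => //; exists i.
exists b => //; exists (a (inK i)); first by exists i.
exact: K_eta_gen.
Qed.

Hypothesis rho_generate : generated (range rho) = [set: B].
Context (F : orbits act -> K_vertex (m := m) rho).
Hypothesis F_mem : forall L, val L (F L).
Hypothesis F_base : forall L, val L = range inr -> F L = K_base rho.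

(** On both sides, the first factor is a standard parabolic subgroup of the
    Coxeter group: it remains to compare the sets of generators, in each of the
    two kinds of ranks. *)
Lemma ms_parabolic_twisting k :
  parabolic (ms_gen G lam) k =
  twisting_parabolic (parabolic a) (parabolic rho) (eta := eta) F
    (ms_type (m := m) rho k).
Proof.
rewrite ms_parabolicE /ms_type; case: (split_ordP k) => i ->.
  rewrite /= cap_parabolicE sorbitE vertex_indexK.
  have -> : [set j : 'I_n.+1 | rshift m.+1 j <> lshift n.+1 i] = [set: _].
    by apply/seteqP; split=> // j _ /= /eqP; rewrite eq_rlshift.
  rewrite rho_generate; congr (generated (a @` _) `*` _).
  apply/seteqP; split=> [_ [b _ [j /= ji <-]]|s /= si].
    by rewrite /= vertex_index_act vertex_indexK => jE; apply: ji; rewrite jE.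
  have [b ->] := vertex_rep s; exists b => //.
  by exists (vertex_index s) => //= /lshift_inj.
rewrite /= cap_parabolicE.
have -> : [set j : 'I_n.+1 | rshift m.+1 j <> rshift m.+1 i] =
    [set j | j <> i].
  apply/seteqP; split=> j /= ji => [jE|/rshift_inj //].
  by apply: ji; rewrite jE.
congr (generated (a @` _) `*` _).
apply/seteqP; split=> [_ [b Hb [j _ <-]] [L _ [Ls /= nLs]]|s ns].
  apply: nLs; exists b => //.
  have [l LE] := orbit_index L; rewrite LE representativeE //.
  move: Ls; rewrite LE /= sorbitE /= vertex_index_act !vertex_indexK.
  by move=> ->.
have [b sE] := vertex_rep s; set j := vertex_index s in sE.
apply/not_notP => nsB; apply: ns; exists (orbit_of act (inK j)) => //.
split; first by rewrite /= sorbitE /= vertex_indexK.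
rewrite representativeE // => -[c Hc cs]; apply: nsB.
by exists c => //; exists j => //= /eqP; rewrite eq_lrshift.
Qed.

End Parabolics.

Theorem corollary3p14 (m n : nat)
    (C : groupType) (c : 'I_m.+1 -> C) (G : coxeterGraph 'I_m.+1)
    (delta_polytope : is_regular_polytope c)
    (delta_universal : is_coxeter_system G c)
    (C_string : is_string c)
    (B : groupType) (rho : 'I_n.+1 -> B)
    (beta_polytope : is_regular_polytope rho)
    (beta_finite : finite_set (lcosets (vertex_group rho)))
    (beta_nontrivial : exists F1 F2 : set B,
      [/\ lcosets (vertex_group rho) F1,
          lcosets (vertex_group rho) F2 & F1 <> F2])
    (lam : diagonal_classes (vertex_group rho) -> label)
    (F : orbits (K_action (m := m) rho) -> K_vertex (m := m) rho)
    (F_mem : forall L : orbits (K_action (m := m) rho), val L (F L))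
    (F_base : forall L : orbits (K_action (m := m) rho),
      val L = range inr -> F L = K_base rho) :
  isomorphic_along (ms_type (m := m) rho)
    (ms_polytope G lam) (K_twisting G lam F).
Proof.
apply: coset_system_isomorphic; first exact: ms_type_bij.
apply: ms_parabolic_twisting => //.
by have [d [P [rk [act [_ []]]]]] := beta_polytope.
Qed.
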